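(* (1) The monoid $\mathcal{L}(\mathbb{I}_1)$ is generated by the group $\mathbb{I}_1^*$ and the element $\int$. (2) For all $n\in\mathbb{N}$, $\mathcal{L}(\mathbb{I}_1)_n=\mathbb{I}_1^*\int^n$. For all $n,m\in\mathbb{N}$, $\mathcal{L}(\mathbb{I}_1)_n\mathcal{L}(\mathbb{I}_1)_m=\mathcal{L}(\mathbb{I}_1)_{n+m}$. (3) The monoid $\mathcal{R}(\mathbb{I}_1)$ is generated by the group $\mathbb{I}_1^*$ and the element $\partial$. (4) For all $n\in\mathbb{N}$, $\mathcal{R}(\mathbb{I}_1)_n=\partial^n\mathbb{I}_1^*$. For all $n,m\in\mathbb{N}$, $\mathcal{R}(\mathbb{I}_1)_n\mathcal{R}(\mathbb{I}_1)_m=\mathcal{R}(\mathbb{I}_1)_{n+m}$.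
   Context: $K$ is a field of characteristic zero, $K^*=K\setminus\{0\}$, $\mathbb{N}=\{0,1,\ldots\}$. $\mathbb{I}_1$ is the subalgebra of $\mathrm{End}_K(K[x])$ generated by (multiplication by) $x$, $\partial=\frac{d}{dx}$ and $\int: x^n\mapsto \frac{x^{n+1}}{n+1}$; $\mathbb{I}_1^*$ is its group of units. Put $e_{ij}:=\int^i\partial^j-\int^{i+1}\partial^{j+1}$ ($i,j\ge0$) and $F:=\bigoplus_{i,j\ge0}Ke_{ij}$, an ideal of $\mathbb{I}_1$. For $a\in\mathbb{I}_1$, $a_{K[x]}:K[x]\to K[x]$, $p\mapsto ap$. $\mathcal{L}(\mathbb{I}_1):=\{a\in\mathbb{I}_1\mid ba=1\text{ for some }b\in\mathbb{I}_1\}$ and $\mathcal{R}(\mathbb{I}_1):=\{b\in\mathbb{I}_1\mid ba=1\text{ for some }a\in\mathbb{I}_1\}$ are multiplicative monoids. For $n\in\mathbb{N}$, $\mathcal{L}(\mathbb{I}_1)_n:=\{a\in(K^*+F)\int^n\mid a_{K[x]}\text{ is injective}\}=\{a\in\mathcal{L}(\mathbb{I}_1)\mid\dim_K(\mathrm{coker}(a_{K[x]}))=n\}$ and $\mathcal{R}(\mathbb{I}_1)_n:=\{b\in\partial^n(K^*+F)\mid b_{K[x]}\text{ is surjective}\}=\{b\in\mathcal{R}(\mathbb{I}_1)\mid\dim_K(\ker(b_{K[x]}))=n\}$. *)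

(* Defs.v *)
From HB Require Import structures.
From mathcomp Require Import all_boot all_order all_algebra.
From mathcomp Require Import boolp classical_sets functions.

Set Implicit Arguments.
Unset Strict Implicit.
Unset Printing Implicit Defensive.

Import GRing.Theory.
Local Open Scope ring_scope.
Local Open Scope classical_set_scope.

Definition End (K : comNzRingType) : Type := {linear {poly K} -> {poly K}}.

Section EndAlgebra.
Context (K : comNzRingType).
Local Notation V := {poly K}.
Implicit Types f g h : End K.

HB.instance Definition _ := gen_eqMixin (End K).
HB.instance Definition _ := gen_choiceMixin (End K).

Lemma End_ext f g : (forall p : V, f p = g p) -> f = g.
Proof.
case: f g => [f cf] [g cg] /= fg; have {fg}E : f = g by apply/funext.
case: _ / E in cg *; congr GRing.Linear.Pack.
case: cf cg => [[p1] [p2]] [[q1] [q2]].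
by rewrite (Prop_irrelevance p1 q1) (Prop_irrelevance p2 q2).
Qed.

Let zero : End K := \0 : {linear V -> V}.
Let opp f : End K := (\- f)%R : {linear V -> V}.
Let add f g : End K := (f \+ g)%R : {linear V -> V}.
Let one : End K := idfun : {linear V -> V}.
Let mul f g : End K := (f \o g) : {linear V -> V}.
Let scale (c : K) f : End K := (c \*: f)%R : {linear V -> V}.

Fact End_addA : associative add.
Proof. by move=> f g h; apply: End_ext => p /=; rewrite addrA. Qed.
Fact End_addC : commutative add.
Proof. by move=> f g; apply: End_ext => p /=; rewrite addrC. Qed.
Fact End_add0 : left_id zero add.
Proof. by move=> f; apply: End_ext => p /=; rewrite add0r. Qed.
Fact End_addN : left_inverse zero opp add.
Proof. by move=> f; apply: End_ext => p /=; rewrite addNr. Qed.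
HB.instance Definition _ :=
  GRing.isZmodule.Build (End K) End_addA End_addC End_add0 End_addN.

Fact End_mulA : associative mul.
Proof. by move=> f g h; apply: End_ext. Qed.
Fact End_mul1l : left_id one mul.
Proof. by move=> f; apply: End_ext. Qed.
Fact End_mul1r : right_id one mul.
Proof. by move=> f; apply: End_ext. Qed.
Fact End_mulDl : left_distributive mul +%R.
Proof. by move=> f g h; apply: End_ext. Qed.
Fact End_mulDr : right_distributive mul +%R.
Proof. by move=> f g h; apply: End_ext => p /=; rewrite linearD. Qed.
Fact End_one_neq0 : one != 0.
Proof.
by apply/eqP => /(congr1 (fun f : End K => f 1)) /eqP; rewrite oner_eq0.
Qed.
HB.instance Definition _ := GRing.Zmodule_isNzRing.Build (End K)
  End_mulA End_mul1l End_mul1r End_mulDl End_mulDr End_one_neq0.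

Fact End_scaleA a b f : scale a (scale b f) = scale (a * b) f.
Proof. by apply: End_ext => p /=; rewrite scalerA. Qed.
Fact End_scale1 : left_id 1 scale.
Proof. by move=> f; apply: End_ext => p /=; rewrite scale1r. Qed.
Fact End_scaleDr : right_distributive scale +%R.
Proof. by move=> a f g; apply: End_ext => p /=; rewrite scalerDr. Qed.
Fact End_scaleDl f : {morph scale^~ f : a b / a + b}.
Proof. by move=> a b; apply: End_ext => p /=; rewrite scalerDl. Qed.
HB.instance Definition _ := GRing.Zmodule_isLmodule.Build K (End K)
  End_scaleA End_scale1 End_scaleDr End_scaleDl.

Fact End_scaleAl a f g : a *: (f * g) = (a *: f) * g.
Proof. by apply: End_ext. Qed.
HB.instance Definition _ := GRing.Lmodule_isLalgebra.Build K (End K) End_scaleAl.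

Fact End_scaleAr a f g : a *: (f * g) = f * (a *: g).
Proof. by apply: End_ext => p /=; rewrite linearZ. Qed.
HB.instance Definition _ := GRing.Lalgebra_isAlgebra.Build K (End K) End_scaleAr.

Lemma End0E p : (0 : End K) p = 0. Proof. by []. Qed.
Lemma End1E p : (1 : End K) p = p. Proof. by []. Qed.
Lemma EndNE f p : (- f) p = - f p. Proof. by []. Qed.
Lemma EndDE f g p : (f + g) p = f p + g p. Proof. by []. Qed.
Lemma EndME f g p : (f * g) p = f (g p). Proof. by []. Qed.
Lemma EndZE c f p : (c *: f) p = c *: f p. Proof. by []. Qed.

End EndAlgebra.

Definition genSubalg (K : comNzRingType) (A : algType K) (G : set A) : set A :=
  smallest (fun S : set A => GRing.subalg_closed [in S]) G.

Definition genSubmonoid (A : pzRingType) (G : set A) : set A :=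
  smallest (fun S : set A => GRing.mulr_closed [in S]) G.

Section IntegroDifferentialOperators.
Context (K : fieldType).
Local Notation P := {poly K}.

Definition mulX_fun (p : P) : P := 'X * p.
Fact mulX_linear : linear mulX_fun.
Proof. by move=> c p q; rewrite /mulX_fun mulrDr scalerAr. Qed.
HB.instance Definition _ := GRing.isLinear.Build K P P _ mulX_fun mulX_linear.

Definition integ_fun (p : P) : P :=
  \sum_(n < size p) (p`_n / n.+1%:R) *: 'X^(n.+1).
Fact coef_integ p i : (integ_fun p)`_i = if i is n.+1 then p`_n / n.+1%:R else 0.
Proof.
rewrite /integ_fun coef_sum; case: i => [|n].
  by apply: big1 => k _; rewrite coefZ coefXn mulr0.
under eq_bigr => k _ do rewrite coefZ coefXn eqSS.
have [ltn|len] := ltnP n (size p); last first.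
  rewrite nth_default// mul0r big1// => k _.
  by rewrite gtn_eqF ?mulr0// (leq_trans (ltn_ord k)).
rewrite (bigD1 (Ordinal ltn))//= eqxx mulr1 big1 ?addr0// => k neq.
by move: neq; rewrite -val_eqE eq_sym /= => /negbTE->; rewrite mulr0.
Qed.
Fact integ_linear : linear integ_fun.
Proof.
move=> c p q; apply/polyP => -[|n]; rewrite coefD coefZ !coef_integ.
  by rewrite mulr0 addr0.
by rewrite coefD coefZ mulrDl mulrA.
Qed.
HB.instance Definition _ := GRing.isLinear.Build K P P _ integ_fun integ_linear.

Definition mulX : End K := mulX_fun : {linear P -> P}.
Definition der : End K := @deriv K : {linear P -> P}.
Definition integ : End K := integ_fun : {linear P -> P}.

Lemma integXn n : integ 'X^n = n.+1%:R^-1 *: 'X^(n.+1).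
Proof.
apply/polyP => -[|k]; rewrite coef_integ coefZ coefXn ?mulr0//.
rewrite coefXn eqSS; case: eqP => [->|_]; first by rewrite mul1r mulr1.
by rewrite mul0r mulr0.
Qed.

Definition I1 : set (End K) := genSubalg [set mulX; der; integ].

Definition I1_units : set (End K) :=
  [set u | I1 u /\ exists2 v, I1 v & u * v = 1 /\ v * u = 1].

Definition eI (i j : nat) : End K :=
  integ ^+ i * der ^+ j - integ ^+ i.+1 * der ^+ j.+1.

(* the K-span of the eI i j, each finite combination being indexed by a square
   [0, n) x [0, n) *)
Definition FI : set (End K) :=
  [set f | exists n (c : 'M[K]_n), f = \sum_i \sum_j c i j *: eI i j].

Definition KFI : set (End K) := [set c%:A + f | c in [set c | c != 0] & f in FI].

Definition LI : set (End K) :=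
  [set a | I1 a /\ exists2 b, I1 b & b * a = 1].
Definition RI : set (End K) :=
  [set b | I1 b /\ exists2 a, I1 a & b * a = 1].

(* Defined by the first of the two usual descriptions; the elements of LIn n (resp
   RIn n) are also those of LI (resp RI) with cokernel (resp kernel) of
   dimension n on {poly K}. *)
Definition LIn (n : nat) : set (End K) :=
  [set a | [set w * integ ^+ n | w in KFI] a /\ injective a].
Definition RIn (n : nat) : set (End K) :=
  [set b | [set der ^+ n * w | w in KFI] b /\ forall q, exists p, b p = q].
End IntegroDifferentialOperators.

Arguments integ {K}.
Arguments der {K}.
Arguments mulX {K}.
Arguments I1 K : clear implicits.
Arguments I1_units K : clear implicits.
Arguments eI K i j : clear implicits.
Arguments FI K : clear implicits.
Arguments KFI K : clear implicits.
Arguments LI K : clear implicits.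
Arguments RI K : clear implicits.
Arguments LIn K n : clear implicits.
Arguments RIn K n : clear implicits.

(* Main.v *)
Require Import Defs.
From mathcomp Require Import all_boot all_algebra.
From mathcomp Require Import boolp classical_sets.
From mathcomp Require Import zify.

Import GRing.Theory.
Local Open Scope ring_scope.
Local Open Scope classical_set_scope.

(**
Write S for integration, T for derivation and e = 1 - S T for the projection
onto the constants. Since T S = 1, the elements S^i e T^j = e_ij are matrix
units; on the divided powers x^n / n! the maps S and T are the two shifts, so
that F consists of the finite matrices in this basis.

Two facts about shifts and finite matrices carry the proof. Suppose that a is
congruent to c S^m T^n modulo F. If a is left cancellable, for instance
injective or left invertible, then n <= m, as otherwise a restricts to a linear
map from a finite-dimensional space to a smaller one ([asymp_left_regular]).
If moreover c is nonzero and n = 0, then a = u S^m with u an invertible element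
of K^* + F: apart from finitely many columns a is a multiple of the shift,
those columns are linearly independent, and completing them to an invertible
matrix produces u ([asymp_unit_completion]).

What remains is to see that one-sided invertible elements of I1 are congruent to
some c S^m T^n with c nonzero. Far enough along the basis, an element of I1 acts
as a finite sum of shifts whose coefficients are polynomials in the index: this
is its symbol. Under composition, the coefficients of highest and of lowest
degree of the symbols multiply, up to translations of the index, and the
polynomials over K form a domain. So if b a = 1, the highest and the lowest
degrees both add up to the same number; both symbols are then monomials, and
their coefficients, being polynomials with product 1, are constants
([symbol_inverse]).

The statements about right invertible elements follow from those about left
invertible ones. If b a = 1 and a = u S^n, then b u is a left inverse of S^n,
and any left inverse of S^n is T^n (1 + g) with g^2 = 0
([left_inverse_exprS]). A surjective b in T^n (K^* + F) has a right inverse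
congruent to a multiple of S^n modulo F ([surjective_right_inverse]), which
reduces it to the same argument.
*)

Set Implicit Arguments.
Unset Strict Implicit.

(** * Matrices in an algebra with a one-sided invertible element *)

Lemma row_full_completion (K : fieldType) n m (B : 'M[K]_(m, n + m)) :
  row_free B -> exists X : 'M[K]_(n, n + m), row_full (col_mx X B).
Proof.
move=> /eqP rB; have := mxrank_compl B; rewrite rB addnK => rC.
have := row_base_free (B^C)%MS; have := eq_row_base (B^C)%MS.
move: (row_base (B^C)%MS); rewrite rC => X eqX _; exists X.
rewrite -sub1mx -addsmxE addsmxC (adds_eqmx (eqmx_refl B) eqX).
by rewrite sub1mx addsmx_compl_full.
Qed.

(** The calculus of matrix units works in any algebra in which T S = 1 and the
    corner of the nonzero idempotent e = 1 - S T is the line K e; [chi] reads off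
    the scalar. *)
Section Jacobson.
Context (K : fieldType) (A : algType K) (S T : A) (chi : A -> K).
Local Notation e := (1 - S * T).
Hypothesis TS1 : T * S = 1.
Hypothesis e_neq0 : e != 0.
Hypothesis corner1 : forall a, e * a * e = chi a *: e.

Let eS : e * S = 0.
Proof. by rewrite mulrBl mul1r -mulrA TS1 mulr1 subrr. Qed.
Let Te : T * e = 0.
Proof. by rewrite mulrBr mulr1 mulrA TS1 mul1r subrr. Qed.
Let ee : e * e = e.
Proof. by rewrite mulrBr mulr1 mulrA eS mul0r subr0. Qed.

Lemma exprTS n : T ^+ n * S ^+ n = 1.
Proof.
by elim: n => [|n IHn]; rewrite ?mulr1// exprSr exprS -mulrA (mulrA T) TS1 mul1r.
Qed.

Lemma exprTSD n k : T ^+ n * S ^+ (n + k) = S ^+ k.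
Proof. by rewrite exprD mulrA exprTS mul1r. Qed.

Lemma exprTDS n k : T ^+ (n + k) * S ^+ n = T ^+ k.
Proof. by rewrite addnC exprD -mulrA exprTS mulr1. Qed.

(** The multiplication rule of matrix units, with arbitrary outer factors x and y
    so that it applies both to S^i e T^j and to its one-sided pieces. *)
Let eTSe x y j k :
  x * e * T ^+ j * (S ^+ k * e * y) = if j == k then x * e * y else 0.
Proof.
have -> : x * e * T ^+ j * (S ^+ k * e * y) = x * e * (T ^+ j * S ^+ k) * e * y.
  by rewrite !mulrA.
case: ltngtP => [lt|lt|->].
- rewrite -(subnKC lt) addSnnS exprTSD exprS -[x * e * _]mulrA [e * (S * _)]mulrA.
  by rewrite eS !(mul0r, mulr0).
- rewrite -(subnKC lt) addSnnS exprTDS exprSr -(mulrA _ (_ * T)) -(mulrA _ T) Te.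
  by rewrite !(mul0r, mulr0).
- by rewrite exprTS mulr1 -(mulrA x) ee.
Qed.

Lemma sum_diag_units n : \sum_(i < n) S ^+ i * e * T ^+ i = 1 - S ^+ n * T ^+ n.
Proof.
elim: n => [|n IHn]; first by rewrite big_ord0 mulr1 subrr.
rewrite big_ord_recr/= IHn mulrBr mulr1 mulrBl exprSr exprS !mulrA.
by rewrite addrA subrK.
Qed.

(** Rectangular matrices are allowed, because S and T change the index ranges. *)
Definition mxop m n (C : 'M[K]_(m, n)) : A :=
  \sum_i \sum_j C i j *: (S ^+ i * e * T ^+ j).

Lemma mxop0 m n : mxop (0 : 'M_(m, n)) = 0.
Proof.
by rewrite /mxop big1// => i _; rewrite big1// => j _; rewrite mxE scale0r.
Qed.

Lemma mxopM m n p (C : 'M[K]_(m, n)) (D : 'M_(n, p)) :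
  mxop C * mxop D = mxop (C *m D).
Proof.
rewrite mulr_suml; apply: eq_bigr => i _; rewrite mulr_suml.
transitivity (\sum_j \sum_l (C i j * D j l) *: (S ^+ i * e * T ^+ l)).
  apply: eq_bigr => j _; rewrite mulr_sumr (bigD1 j)//= [X in _ + X]big1 ?addr0.
    rewrite mulr_sumr; apply: eq_bigr => l _.
    by rewrite -scalerAl -scalerAr scalerA eTSe eqxx.
  move=> k kj; rewrite mulr_sumr big1// => l _.
  by rewrite -scalerAl -scalerAr eTSe val_eqE eq_sym (negPf kj) !scaler0.
rewrite exchange_big; apply: eq_bigr => l _; rewrite -scaler_suml.
by rewrite !mxE.
Qed.

Lemma mxop1 n : mxop (1%:M : 'M_n) = 1 - S ^+ n * T ^+ n.
Proof.
rewrite -sum_diag_units; apply: eq_bigr => i _.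
rewrite (bigD1 i)//= mxE eqxx scale1r big1 ?addr0// => j ji.
by rewrite mxE eq_sym (negPf ji) scale0r.
Qed.

Lemma exprT_mxop m n (C : 'M[K]_(m, n)) : T ^+ m * mxop C = 0.
Proof.
rewrite -[C]mul1mx -mxopM mxop1 mulrA mulrBr mulrA exprTS mul1r mulr1.
by rewrite subrr mul0r.
Qed.

Lemma mxop_exprS m n (C : 'M[K]_(m, n)) : mxop C * S ^+ n = 0.
Proof.
rewrite -[C]mulmx1 -mxopM mxop1 -mulrA mulrBl -mulrA exprTS mul1r mulr1.
by rewrite subrr mulr0.
Qed.

Lemma mxop_coef m n (C : 'M[K]_(m, n)) (i : 'I_m) (j : 'I_n) :
  e * T ^+ i * mxop C * (S ^+ j * e) = C i j *: e.
Proof.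
have lS (k l : nat) : e * T ^+ k * (S ^+ l * e) = if k == l then e else 0.
  by have := eTSe 1 1 k l; rewrite !mulr1 !mul1r.
have lST (k l p : nat) : e * T ^+ k * (S ^+ l * e * T ^+ p) =
    if k == l then e * T ^+ p else 0.
  by have := eTSe 1 (T ^+ p) k l; rewrite !mul1r.
rewrite mulr_sumr mulr_suml (bigD1 i)//= [X in _ + X]big1 ?addr0.
  rewrite mulr_sumr mulr_suml (bigD1 j)//= [X in _ + X]big1 ?addr0.
    by rewrite -scalerAr -scalerAl lST eqxx lS eqxx.
  move=> l lj; rewrite -scalerAr -scalerAl lST eqxx lS.
  by rewrite val_eqE (negPf lj) scaler0.
move=> k ki; rewrite mulr_sumr mulr_suml big1// => l _.
by rewrite -scalerAr lST val_eqE eq_sym (negPf ki) scaler0 mul0r.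
Qed.

Lemma mxop_inj0 m n (C : 'M[K]_(m, n)) : mxop C = 0 -> C = 0.
Proof.
move=> C0; apply/matrixP => i j; rewrite mxE.
have /eqP := mxop_coef C i j; rewrite C0 mulr0 mul0r eq_sym scaler_eq0.
by rewrite (negPf e_neq0) orbF => /eqP.
Qed.

(** The two conditions say that g is unchanged by the idempotents 1 - S^m T^m on
    the left and 1 - S^n T^n on the right; expanding these into diagonal matrix
    units displays the entries of g. This turns the purely multiplicative
    description of F used below into matrices. *)
Lemma corner_mxop m n g : T ^+ m * g = 0 -> g * S ^+ n = 0 ->
  exists C : 'M_(m, n), g = mxop C.
Proof.
move=> Tg gS; exists (\matrix_(i, j) chi (T ^+ i * g * S ^+ j)).
have gE : g = (1 - S ^+ m * T ^+ m) * g * (1 - S ^+ n * T ^+ n).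
  by rewrite mulrBl -mulrA Tg mulr0 subr0 mulrBr mulr1 mul1r mulrA gS mul0r subr0.
rewrite {1}gE -!sum_diag_units !mulr_suml; apply: eq_bigr => i _.
rewrite mulr_sumr; apply: eq_bigr => j _; rewrite !mxE.
by rewrite scalerAl scalerAr -corner1 !mulrA.
Qed.

(** Multiplying by S^m on the right shifts the columns and drops the first m. *)
Lemma mxop_row_exprS p m n (X : 'M[K]_(p, m)) (Y : 'M_(p, n)) :
  mxop (row_mx X Y) * S ^+ m = mxop Y.
Proof.
rewrite mulr_suml; apply: eq_bigr => i _; rewrite big_split_ord/= mulrDl.
rewrite [X in X + _]mulr_suml [X in X + _]big1 ?add0r => [|j _].
  rewrite mulr_suml; apply: eq_bigr => j _.
  by rewrite row_mxEr -scalerAl -(mulrA (S ^+ i * e))/= exprTDS.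
have -> : S ^+ m = S ^+ (j + (m - j.+1).+1) by rewrite -addSnnS subnKC.
rewrite -scalerAl -(mulrA (S ^+ i * e))/= exprTSD exprS -(mulrA (S ^+ i)).
by rewrite [e * (S * _)]mulrA eS mul0r mulr0 scaler0.
Qed.

(** * Congruence to a multiple of a shift modulo finite matrices *)

(** This says that a is congruent to c S^m T^n modulo F. An element f is in F
    exactly when some power of T kills it from the left and some power of S from
    the right; for f = a - c S^m T^n this becomes two equations between a and
    powers of S and T, which compose well. *)
Definition asymp (c : K) (m n : nat) (a : A) : Prop := exists N,
  a * S ^+ (n + N) = c *: S ^+ (m + N) /\ T ^+ (m + N) * a = c *: T ^+ (n + N).

Definition left_regular (a : A) := forall f, a * f = 0 -> f = 0.

Lemma asymp_mxop c m n a : asymp c m n a ->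
  exists N (C : 'M_(m + N, n + N)),
    a = c *: (S ^+ (m + N) * T ^+ (n + N)) + mxop C.
Proof.
move=> [N [aS Ta]]; exists N.
pose g := a - c *: (S ^+ (m + N) * T ^+ (n + N)).
have [||C aC] := @corner_mxop (m + N) (n + N) g.
- by rewrite mulrBr Ta -scalerAr mulrA exprTS mul1r subrr.
- by rewrite mulrBl aS -scalerAl -mulrA exprTS mulr1 subrr.
by exists C; rewrite -aC /g addrC subrK.
Qed.

(** A nonzero vector in the kernel of C would be a nonzero f with a f = 0, since
    T^(n + N) kills all matrices with n + N rows. *)
Lemma left_regular_mx c m n a N (C : 'M_(m + N, n + N)) :
  a = c *: (S ^+ (m + N) * T ^+ (n + N)) + mxop C ->
  left_regular a -> row_free C^T.
Proof.
move=> aE rega; rewrite -kermx_eq0; apply/eqP/trmx_inj; rewrite trmx0.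
apply: mxop_inj0; apply: rega; rewrite aE mulrDl -scalerAl -mulrA exprT_mxop.
by rewrite mulr0 scaler0 add0r mxopM -{1}[C]trmxK -trmx_mul mulmx_ker trmx0 mxop0.
Qed.

(** An injective linear map cannot lower the dimension: C has m + N rows and
    n + N linearly independent columns. *)
Lemma asymp_left_regular c m n a : asymp c m n a -> left_regular a -> (n <= m)%N.
Proof.
move=> /asymp_mxop[N [C aE]] /(left_regular_mx aE) /eqP rC.
by have := rank_leq_col C^T; rewrite rC leq_add2r.
Qed.

(** Here C has n + N rows and only N columns, which are independent. The unit u is
    the invertible square matrix U obtained by adding n columns on the left,
    extended by c on the remaining basis vectors; the right factor S^n discards
    exactly the added columns. *)
Lemma asymp_unit_completion c n a : c != 0 -> asymp c n 0 a -> left_regular a ->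
  exists u v, [/\ asymp c 0 0 u, asymp c^-1 0 0 v, u * v = 1, v * u = 1 &
    a = u * S ^+ n].
Proof.
move=> c0 /asymp_mxop[N [C aE]] /(left_regular_mx aE) rC.
rewrite add0n in C aE rC.
have [X] := row_full_completion rC.
rewrite -[C]trmxK -[X]trmxK -tr_row_mx.
set U := row_mx X^T C^T^T; rewrite row_full_unit unitmx_tr => uU.
have mu c1 c2 (M1 M2 : 'M_(n + N)) : c1 * c2 = 1 -> M1 *m M2 = 1%:M ->
  (c1 *: (S ^+ (n + N) * T ^+ (n + N)) + mxop M1) *
  (c2 *: (S ^+ (n + N) * T ^+ (n + N)) + mxop M2) = 1.
  move=> c12 M12; rewrite mulrDl !mulrDr -!scalerAl -!scalerAr scalerA c12.
  rewrite scale1r.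
  rewrite mulrA -(mulrA (S ^+ _)) exprTS mulr1 -(mulrA (S ^+ _)) exprT_mxop.
  rewrite mulrA mxop_exprS mxopM M12 mxop1 mul0r mulr0 !scaler0 addr0 add0r.
  by rewrite addrC subrK.
have as_ c1 (M1 : 'M_(n + N)) :
    asymp c1 0 0 (c1 *: (S ^+ (n + N) * T ^+ (n + N)) + mxop M1).
  exists (n + N)%N; rewrite !add0n mulrDl mulrDr mxop_exprS exprT_mxop !addr0.
  by rewrite -scalerAl -scalerAr -mulrA !exprTS mulr1 mulrA exprTS mul1r.
exists (c *: (S ^+ (n + N) * T ^+ (n + N)) + mxop U).
exists (c^-1 *: (S ^+ (n + N) * T ^+ (n + N)) + mxop (invmx U)).
split=> //; first by apply: mu; rewrite ?mulfV ?mulmxV.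
  by apply: mu; rewrite ?mulVf ?mulVmx.
rewrite aE mulrDl mxop_row_exprS trmxK; congr (_ + _).
by rewrite -scalerAl -mulrA exprTDS.
Qed.

Lemma asympW c m n k a : asymp c (m + k) (n + k) a -> asymp c m n a.
Proof. by move=> [N]; rewrite -!addnA => ?; exists (k + N)%N. Qed.

Lemma asymp_eventually c m n a : asymp c m n a ->
  exists N, forall M, (N <= M)%N ->
  a * S ^+ (n + M) = c *: S ^+ (m + M) /\ T ^+ (m + M) * a = c *: T ^+ (n + M).
Proof.
move=> [N [aS Ta]]; exists N => M /subnKC <-; move: (M - N)%N => k.
rewrite !addnA [in a * _]exprD mulrA aS -scalerAl -exprD; split=> //.
by rewrite [in _ * a]addnC exprD -mulrA Ta -scalerAr -exprD addnC.
Qed.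

Lemma asympM c d m n p a b : asymp c m n a -> asymp d n p b ->
  asymp (c * d) m p (a * b).
Proof.
move=> /asymp_eventually[N ha] /asymp_eventually[N' hb].
exists (maxn N N').
have [aS Ta] := ha _ (leq_maxl N N'); have [bS Tb] := hb _ (leq_maxr N N').
split; first by rewrite -mulrA bS -scalerAr aS scalerA mulrC.
by rewrite mulrA Ta -scalerAl Tb scalerA.
Qed.

Lemma asympD c d m n a b : asymp c m n a -> asymp d m n b ->
  asymp (c + d) m n (a + b).
Proof.
move=> /asymp_eventually[N ha] /asymp_eventually[N' hb].
exists (maxn N N').
have [aS Ta] := ha _ (leq_maxl N N'); have [bS Tb] := hb _ (leq_maxr N N').
by rewrite mulrDl mulrDr aS bS Ta Tb !scalerDl.
Qed.

Lemma asympZ c m n k a : asymp c m n a -> asymp (k * c) m n (k *: a).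
Proof.
by move=> [N [aS Ta]]; exists N; rewrite -scalerAl -scalerAr aS Ta !scalerA.
Qed.

Lemma asympST m n : asymp 1 m n (S ^+ m * T ^+ n).
Proof.
exists 0; rewrite !addn0 !scale1r -mulrA exprTS mulr1; split=> //.
by rewrite mulrA exprTS mul1r.
Qed.

Lemma asympS c m n k a : asymp c m n a -> asymp c (m + k) (n + k) a.
Proof.
move=> /asymp_eventually[N h]; exists N; rewrite -!addnA.
by apply: h; apply: leq_addl.
Qed.

(** The witness a T^n already satisfies a = w S^n; adding c on the first n basis
    vectors, which S^n misses, makes it congruent to c. *)
Lemma asymp_left_shift c n a : asymp c n 0 a ->
  exists2 w, asymp c 0 0 w & a = w * S ^+ n.
Proof.
move=> ha; exists (a * T ^+ n + c *: (1 - S ^+ n * T ^+ n)); last first.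
  by rewrite mulrDl -mulrA exprTS mulr1 -scalerAl mulrBl mul1r -mulrA exprTS
             mulr1 subrr scaler0 addr0.
apply: (@asympW _ _ _ n); rewrite add0n.
(* The scalars are kept unsimplified to match the sum and product rules. *)
have : asymp (c * 1 + c * (1 + -1 * 1)) n n
    (a * T ^+ n + c *: (1 - S ^+ n * T ^+ n)).
  apply: asympD; first by apply: asympM ha _; have := asympST 0 n; rewrite mul1r.
  apply: asympZ; apply: asympD; last by rewrite -scaleN1r; apply/asympZ/asympST.
  by have := asympS n (asympST 0 0); rewrite mul1r.
by rewrite !mulr1 subrr mulr0 addr0.
Qed.

Lemma asymp_right_shift c n b : asymp c 0 n b ->
  exists2 w, asymp c 0 0 w & b = T ^+ n * w.
Proof.
move=> hb; exists (S ^+ n * b + c *: (1 - S ^+ n * T ^+ n)); last first.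
  by rewrite mulrDr mulrA exprTS mul1r -scalerAr mulrBr mulr1 mulrA exprTS
             mul1r subrr scaler0 addr0.
apply: (@asympW _ _ _ n); rewrite add0n.
(* The scalars are kept unsimplified to match the sum and product rules. *)
have : asymp (1 * c + c * (1 + -1 * 1)) n n
    (S ^+ n * b + c *: (1 - S ^+ n * T ^+ n)).
  apply: asympD; first by apply: asympM hb; have := asympST n 0; rewrite mulr1.
  apply: asympZ; apply: asympD; last by rewrite -scaleN1r; apply/asympZ/asympST.
  by have := asympS n (asympST 0 0); rewrite mul1r.
by rewrite mul1r mulr1 subrr mulr0 addr0.
Qed.

(** A left inverse of S^n differs from T^n by b (1 - S^n T^n), which vanishes on
    the range of S^n. Since 1 + g is invertible, with inverse 1 - g, left inverses
    of S^n are T^n times units. *)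
Lemma left_inverse_exprS b n : b * S ^+ n = 1 ->
  let g := S ^+ n * b * (1 - S ^+ n * T ^+ n) in
  g * g = 0 /\ b = T ^+ n * (1 + g).
Proof.
move=> bS /=; split.
  rewrite -!mulrA (mulrA (1 - _) (S ^+ n)) mulrBl mul1r -(mulrA (S ^+ n)) exprTS.
  by rewrite mulr1 subrr mul0r !mulr0.
rewrite mulrDr mulr1 !mulrA exprTS mul1r mulrBr mulr1 mulrA bS mul1r.
by rewrite addrC subrK.
Qed.

Lemma left_regular_left_inverse a b : b * a = 1 -> left_regular a.
Proof. by move=> ba f af; rewrite -[f]mul1r -ba -mulrA af mulr0. Qed.

End Jacobson.

(** * Divided powers and symbols *)

Section Operators.
Context (K : fieldType) (charK0 : [pchar K] =i pred0).
Local Notation P := {poly K}.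
Local Notation "∫" := (@integ K).
Local Notation "∂" := (@der K).

Let natrS_neq0 n : n.+1%:R != 0 :> K.
Proof. by rewrite ((pcharf0P K).1 charK0). Qed.
Let fact_neq0 n : n`!%:R != 0 :> K.
Proof. by rewrite ((pcharf0P K).1 charK0) -lt0n fact_gt0. Qed.

Lemma coef_der (p : P) i : (∂ p)`_i = p`_i.+1 * i.+1%:R.
Proof. by rewrite coef_deriv mulr_natr. Qed.

Lemma der_integ : ∂ * ∫ = 1.
Proof.
apply: End_ext => p; apply/polyP => i; rewrite EndME coef_der coef_integ.
by rewrite mulfVK.
Qed.

Definition const_term (f : End K) : K := (f 1)`_0.

Lemma vacuum_projE (p : P) : (1 - ∫ * ∂) p = (p`_0)%:P.
Proof.
apply/polyP => -[|i]; rewrite EndDE EndNE EndME coefB coefC coef_integ ?subr0//=.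
by rewrite coef_der mulfK// subrr.
Qed.

Lemma vacuum_proj_neq0 : 1 - ∫ * ∂ != 0 :> End K.
Proof.
apply/eqP => /(congr1 (fun f : End K => f 1)); rewrite vacuum_projE coef1 End0E.
by move/eqP; rewrite oner_eq0.
Qed.

(** The corner is one-dimensional because e has rank one. *)
Lemma vacuum_corner (f : End K) :
  (1 - ∫ * ∂) * f * (1 - ∫ * ∂) = const_term f *: (1 - ∫ * ∂).
Proof.
apply: End_ext => p; rewrite EndZE !EndME !vacuum_projE.
by rewrite -(alg_polyC p`_0) linearZ coefZ polyCM mulrC -!mul_polyC mulr1.
Qed.

(** The divided powers x^n / n!, the basis in which integration and derivation are
    the two shifts. *)
Definition xi n : P := n`!%:R^-1 *: 'X^n.

Lemma coef_xi n i : (xi n)`_i = (i == n)%:R / n`!%:R.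
Proof. by rewrite coefZ coefXn mulrC. Qed.

Lemma integ_xi n : ∫ (xi n) = xi n.+1.
Proof. by rewrite /xi linearZ/= integXn scalerA factS natrM invfM mulrC. Qed.

Lemma der_xi n : ∂ (xi n.+1) = xi n.
Proof. by rewrite -integ_xi -EndME der_integ. Qed.

Lemma mulX_xi n : mulX (xi n) = n.+1%:R *: xi n.+1.
Proof.
rewrite /mulX/= /mulX_fun /xi -scalerAr -exprS scalerA factS natrM invfM mulrA.
by rewrite mulfV// mul1r.
Qed.

Lemma expr_integ_xi m n : (∫ ^+ m) (xi n) = xi (m + n).
Proof. by elim: m => // m IHm; rewrite exprS EndME IHm integ_xi. Qed.

Lemma End_ext_xi (f g : End K) : (forall n, f (xi n) = g (xi n)) -> f = g.
Proof.
move=> fg; apply: End_ext => p; rewrite -[p]coefK poly_def !linear_sum.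
apply: eq_bigr => i _.
have -> : 'X^i = i`!%:R *: xi i by rewrite scalerA mulfV ?scale1r.
by move: (xi i) (fg i) => q fgq; rewrite !linearZ/= fgq.
Qed.

(** A polynomial s over K[t] is a list of coefficients depending polynomially on an
    index; evaluating them at n and letting the outer variable act as the shift
    gives the image of the n-th basis vector, up to a fixed translation. *)
Definition symb (s : {poly P}) n : P :=
  \sum_(i < size s) (s`_i).[n%:R] *: xi (n + i).

Lemma coef_symb s n i : (symb s n)`_i =
  if (i < n)%N then 0 else (s`_(i - n)).[n%:R] / i`!%:R.
Proof.
rewrite coef_sum; under eq_bigr => k _ do rewrite coefZ coef_xi.
case: ltnP => [lt|/subnKC iE].
  by apply: big1 => k _; rewrite ltn_eqF ?mul0r ?mulr0// ltn_addr.
have [lts|les] := ltnP (i - n) (size s); last first.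
  rewrite [s`_(i - n)]nth_default// horner0 mul0r big1// => k _.
  rewrite gtn_eqF ?mul0r ?mulr0// -iE ltn_add2l.
  exact: leq_trans (ltn_ord k) les.
rewrite (bigD1 (Ordinal lts))//= iE eqxx mul1r big1 ?addr0// => k kneq.
by rewrite -{1}iE eqn_add2l eq_sym (negPf (kneq : k != _ :> nat)) mul0r mulr0.
Qed.

Lemma symbD s t n : symb (s + t) n = symb s n + symb t n.
Proof.
apply/polyP => i; rewrite coefD !coef_symb; case: ifP; rewrite ?addr0//.
by rewrite coefD hornerD mulrDl.
Qed.

Lemma symbZ p s n : symb (p *: s) n = p.[n%:R] *: symb s n.
Proof.
apply/polyP => i; rewrite coefZ !coef_symb; case: ifP; rewrite ?mulr0//.
by rewrite coefZ hornerM mulrA.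
Qed.

Lemma symb0 n : symb 0 n = 0.
Proof. by rewrite /symb size_poly0 big_ord0. Qed.

Lemma symb_sum (I : finType) (F : I -> {poly P}) n :
  symb (\sum_i F i) n = \sum_i symb (F i) n.
Proof.
by apply: (big_morph (symb^~ n)); [exact: (fun s t => symbD s t n)|exact: symb0].
Qed.

Lemma symbXn k n : symb 'X^k n = xi (n + k).
Proof.
apply/polyP => i; rewrite coef_symb coefXn coef_xi; case: ltnP => [lt|/subnKC iE].
  by rewrite ltn_eqF ?mul0r// ltn_addr.
rewrite -[in RHS]iE eqn_add2l; case: eqP => [E|_]; last by rewrite horner0 !mul0r.
by rewrite hornerC -{1}iE E.
Qed.

Lemma symb_shift s i n :
  symb (map_poly (comp_poly ('X + i%:R%:P)) s * 'X^i) n = symb s (n + i).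
Proof.
apply/polyP => k; rewrite !coef_symb coefMXn coef_map/=.
case: (ltnP k n) => [lt|le]; first by rewrite ltn_addr.
rewrite ltn_subLR// subnDA; case: ifP; rewrite ?horner0 ?mul0r//.
by rewrite horner_comp !hornerE natrD.
Qed.

(** In characteristic zero the natural numbers give infinitely many roots. *)
Lemma poly_eq0_nat (p : P) : (forall n : nat, p.[n%:R] = 0) -> p = 0.
Proof.
move=> p0; apply: (@roots_geq_poly_eq0 _ p [seq n%:R | n <- iota 0 (size p)]).
- by apply/allP => _ /mapP[n _ ->]; apply/rootP.
- rewrite map_inj_uniq ?iota_uniq// => m n /eqP.
  wlog le : m n / (m <= n)%N => [H|].
    by case/orP: (leq_total m n) => [/H//|/H {}H]; rewrite eq_sym => /H.
  rewrite eq_sym -subr_eq0 -natrB// ((pcharf0P K).1 charK0) subn_eq0 => le'.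
  by apply/eqP; rewrite eqn_leq le.
- by rewrite size_map size_iota.
Qed.

Lemma symb_inj s t : (forall n, symb s n = symb t n) -> s = t.
Proof.
move=> st; apply/polyP => k; apply/eqP; rewrite -subr_eq0; apply/eqP.
apply: poly_eq0_nat => n; have := congr1 (fun p : P => p`_(n + k)) (st n).
rewrite !coef_symb ltnNge leq_addr/= addKn => /(mulIf _) E.
by rewrite !hornerE E ?subrr// invr_neq0.
Qed.

(** The translation by N makes room for operators of negative degree, and lets the
    first N basis vectors be treated as exceptions. *)
Definition has_symbol N s (a : End K) := forall n, a (xi (n + N)) = symb s n.

Lemma has_symbol_widen N s a k : has_symbol N s a ->
  has_symbol (k + N) (map_poly (comp_poly ('X + k%:R%:P)) s * 'X^k) a.
Proof. by move=> h n; rewrite addnA h symb_shift. Qed.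

(** The product of a skew polynomial ring: passing from the i-th shift to the next
    operator moves the index by i. *)
Definition twisted_mul (M : nat) (t s : {poly P}) : {poly P} :=
  \sum_(i < size s) (s`_i \Po ('X + M%:R%:P)) *:
    (map_poly (comp_poly ('X + i%:R%:P)) t * 'X^i).

Lemma has_symbolM N s a M t b : has_symbol N s a -> has_symbol M t b ->
  has_symbol (M + N) (twisted_mul M t s) (b * a).
Proof.
move=> ha hb n; rewrite EndME addnA ha symb_sum linear_sum; apply: eq_bigr => i _.
by rewrite linearZ/= addnAC hb symbZ symb_shift horner_comp !hornerE natrD.
Qed.

(** When the pair (I, J) is the only one of its total degree that contributes, the
    coefficient is a single product. This covers both extreme degrees. *)
Lemma coef_twisted_mul M (t s : {poly P}) I J :
  (forall i j, (i + j = I + J)%N -> i != I -> s`_i = 0 \/ t`_j = 0) ->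
  (twisted_mul M t s)`_(I + J) =
    (s`_I \Po ('X + M%:R%:P)) * (t`_J \Po ('X + I%:R%:P)).
Proof.
move=> st; rewrite coef_sum.
have term i : ((s`_i \Po ('X + M%:R%:P)) *:
    (map_poly (comp_poly ('X + i%:R%:P)) t * 'X^i))`_(I + J) =
    if (I + J < i)%N then 0
    else (s`_i \Po ('X + M%:R%:P)) * (t`_(I + J - i) \Po ('X + i%:R%:P)).
  by rewrite coefZ coefMXn coef_map/=; case: ifP; rewrite ?mulr0.
under eq_bigr => i _ do rewrite term.
have [lt|le] := ltnP I (size s); last first.
  rewrite [s`_I]nth_default// comp_poly0 mul0r big1// => i _.
  case: ltnP => // /subnKC E; have [||->|->] := st i (I + J - i)%N => //;
    rewrite ?comp_poly0 ?mul0r ?mulr0//.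
  by rewrite neq_ltn (leq_trans (ltn_ord i) le).
rewrite (bigD1 (Ordinal lt))//= ltnNge leq_addr addKn big1 ?addr0// => i iI.
by case: ltnP => // /subnKC E; have [||->|->] := st i (I + J - i)%N => //;
  rewrite ?comp_poly0 ?mul0r ?mulr0.
Qed.


Lemma poly_one_coef (s : {poly P}) (i0 I : nat) :
  (forall i, s`_i != 0 -> (i0 <= i <= I)%N) -> i0 = I -> s = s`_I *: 'X^I.
Proof.
move=> h e; apply/polyP => i; rewrite coefZ coefXn; case: eqP => [->|ne].
  by rewrite mulr1.
rewrite mulr0; apply/eqP; apply/negP => /negP /h.
by rewrite e -eqn_leq => /eqP /esym.
Qed.

Lemma poly_support (s : {poly P}) : s != 0 -> exists i0 I,
  [/\ s`_i0 != 0, s`_I != 0 & forall i, s`_i != 0 -> (i0 <= i <= I)%N].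
Proof.
move=> s0; have sI : s`_(size s).-1 != 0 by rewrite -lead_coefE lead_coef_eq0.
have ex : exists i, s`_i != 0 by exists (size s).-1.
case: (ex_minnP ex) => i0 si0 min; exists i0, (size s).-1; split=> // i si.
rewrite min//= -ltnS prednK ?size_poly_gt0// ltnNge.
by apply: contra si => /(nth_default 0) ->.
Qed.

Lemma comp_shift_neq0 (p : P) c : p != 0 -> p \Po ('X + c%:P) != 0.
Proof.
by move=> p0; rewrite -size_poly_eq0 size_comp_poly2 ?size_XaddC// size_poly_eq0.
Qed.

(** The twisted product of the symbols is the monomial of degree M + N. Its lowest
    and highest terms come from the lowest and highest terms of the factors, so
    that i0 + j0 = M + N = I + J, which forces i0 = I and j0 = J. *)
Lemma symbol_inverse N s a M t b : has_symbol N s a -> has_symbol M t b ->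
  b * a = 1 -> exists c d I J, [/\ c * d = 1, (I + J = M + N)%N,
    s = c%:P *: 'X^I & t = d%:P *: 'X^J].
Proof.
move=> ha hb ba1; have r1 : twisted_mul M t s = 'X^(M + N).
  by apply: symb_inj => n; rewrite -(has_symbolM ha hb) ba1 symbXn.
have rL : (twisted_mul M t s)`_(M + N) = 1 by rewrite r1 coefXn eqxx.
have s0 : s != 0.
  apply/eqP => s0; move/eqP: rL; rewrite -[X in _`_X]addn0 coef_twisted_mul.
    by rewrite s0 coef0 comp_poly0 mul0r eq_sym oner_eq0.
  by move=> i j _ _; rewrite s0 coef0; left.
have t0 : t != 0.
  apply/eqP => t0; move/eqP: rL; rewrite -[X in _`_X]addn0 coef_twisted_mul.
    by rewrite t0 coef0 comp_poly0 mulr0 eq_sym oner_eq0.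
  by move=> i j _ _; rewrite t0 coef0; right.
have [i0 [I [si0 sI sP]]] := poly_support s0.
have [j0 [J [tj0 tJ tP]]] := poly_support t0.
have key i j : s`_i != 0 -> t`_j != 0 ->
    (forall i' j', (i' + j' = i + j)%N -> i' != i -> s`_i' = 0 \/ t`_j' = 0) ->
    (i + j = M + N)%N /\
    (s`_i \Po ('X + M%:R%:P)) * (t`_j \Po ('X + i%:R%:P)) = 1.
  move=> si tj /(@coef_twisted_mul M t s); rewrite r1 coefXn.
  case: eqP => [-> <-//|_ /esym/eqP].
  rewrite mulf_eq0 (negPf (comp_shift_neq0 _ si)).
  by rewrite (negPf (comp_shift_neq0 _ tj)).
have zero i j : (i0 <= i <= I)%N && (j0 <= j <= J)%N = false ->
    s`_i = 0 \/ t`_j = 0.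
  case: (eqVneq s`_i 0) => [|/sP ->]; first by left.
  by case: (eqVneq t`_j 0) => [|/tP ->//]; right.
have [|bot _] := key i0 j0 si0 tj0.
  by move=> i j ij ii; apply: zero; lia.
have [|top E] := key I J sI tJ.
  by move=> i j ij ii; apply: zero; lia.
have /andP[leI _] := sP _ sI.
have /andP[leJ _] := tP _ tJ.
have eI : i0 = I by lia.
have eJ : j0 = J by lia.
(* A product of polynomials equal to 1 has factors of degree 0. *)
have sE := poly_one_coef sP eI; have tE := poly_one_coef tP eJ.
have : size ((s`_I \Po ('X + M%:R%:P)) * (t`_J \Po ('X + I%:R%:P))) == 1%N.
  by rewrite E size_poly1.
rewrite size_mul_eq1 !size_comp_poly2 ?size_XaddC//.
case/andP => /size_poly1P[c c0 sc] /size_poly1P[d d0 td].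
exists c, d, I, J; rewrite -sc -td; split=> //.
by apply: (@polyC_inj K); rewrite polyCM polyC1 -E sc td !comp_polyC.
Qed.


(** * Operators in I1 *)

Lemma genSubalg_closed (A : algType K) (G : set A) :
  [/\ genSubalg G 1,
      forall c a b, genSubalg G a -> genSubalg G b -> genSubalg G (c *: a + b) &
      forall a b, genSubalg G a -> genSubalg G b -> genSubalg G (a * b)].
Proof.
split.
- by move=> M [[+ _ _] _]; rewrite inE.
- move=> c a b Ga Gb M CM; have [[_ + _] _] := CM => /(_ c a b).
  by rewrite !inE; apply; [exact: Ga CM | exact: Gb CM].
- move=> a b Ga Gb M CM; have [[_ _ +] _] := CM => /(_ a b).
  by rewrite !inE; apply; [exact: Ga CM | exact: Gb CM].
Qed.

Lemma I1_1 : I1 K 1. Proof. by case: (genSubalg_closed [set mulX; ∂; ∫]). Qed.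
Lemma I1_M a b : I1 K a -> I1 K b -> I1 K (a * b).
Proof. by case: (genSubalg_closed [set mulX; ∂; ∫]) => _ _; apply. Qed.
Lemma I1_lin c a b : I1 K a -> I1 K b -> I1 K (c *: a + b).
Proof. by case: (genSubalg_closed [set mulX; ∂; ∫]) => _ + _; apply. Qed.
Lemma I1_Z c a : I1 K a -> I1 K (c *: a).
Proof.
move=> Ia; have I0 : I1 K 0.
  by rewrite -(addNr 1) -scaleN1r; apply: I1_lin I1_1 I1_1.
by rewrite -[_ *: _]addr0; apply: I1_lin.
Qed.
Lemma I1_D a b : I1 K a -> I1 K b -> I1 K (a + b).
Proof. by move=> Ia Ib; rewrite -[a]scale1r; apply: I1_lin. Qed.
Lemma I1_B a b : I1 K a -> I1 K b -> I1 K (a - b).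
Proof. by move=> Ia Ib; rewrite addrC -scaleN1r; apply: I1_lin. Qed.
Lemma I1_X a n : I1 K a -> I1 K (a ^+ n).
Proof.
by move=> Ia; elim: n => [|n IHn]; [exact: I1_1 | rewrite exprS; apply: I1_M].
Qed.
Lemma I1_sum n (F : 'I_n -> End K) : (forall i, I1 K (F i)) -> I1 K (\sum_i F i).
Proof.
move=> IF; apply: (big_ind (I1 K)) => //; last exact: I1_D.
by rewrite -[X in I1 K X](scale0r (1 : End K)); apply: I1_Z I1_1.
Qed.
Lemma I1_integ : I1 K ∫.
Proof. by move=> M [_ GM]; apply: GM; right. Qed.
Lemma I1_der : I1 K ∂.
Proof. by move=> M [_ GM]; apply: GM; left; right. Qed.

Lemma I1_has_symbol a : I1 K a -> exists N s, has_symbol N s a.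
Proof.
apply: (@smallest_sub _ _ _ [set a | exists N s, has_symbol N s a]).
  split.
  - by rewrite inE; exists 0, 'X^0 => n; rewrite symbXn addn0.
  - move=> c u v; rewrite !inE => -[N [s hs]] [M [t ht]].
    have hs' := has_symbol_widen M hs.
    have := has_symbol_widen N ht; rewrite [(N + M)%N]addnC => ht'.
    exists (M + N)%N; eexists => n.
    rewrite EndDE EndZE hs' ht' -{1}[c](hornerC c n%:R) -symbZ -symbD.
    by reflexivity.
  - move=> u v; rewrite !inE => -[N [s hs]] [M [t ht]].
    by exists (N + M)%N; eexists; apply: has_symbolM.
move=> _ [[->|->]|->].
- exists 0, (('X + 1%:P) *: 'X^1) => n.
  by rewrite addn0 symbZ symbXn mulX_xi !hornerE addn1 -natr1.
- by exists 1, 'X^0 => n; rewrite symbXn addn0 addn1 der_xi.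
- by exists 0, 'X^1 => n; rewrite symbXn addn0 addn1 integ_xi.
Qed.

Local Notation asymp := (@asymp K (End K) ∫ ∂).

Lemma expr_derE n (p : P) : (∂ ^+ n) p = p^`(n).
Proof. by elim: n => // n IHn; rewrite exprS EndME IHn derivnS. Qed.

(** Such an f is determined by its values on the first N basis vectors, and these
    have bounded degree. *)
Lemma expr_der_kill f N : f * ∫ ^+ N = 0 -> exists L, ∂ ^+ L * f = 0.
Proof.
move=> f0; exists (\max_(i < N) size (f (xi i))); apply: End_ext_xi => n.
rewrite EndME; have [lt|/subnKC <-] := ltnP n N.
  rewrite expr_derE; apply: derivn_poly0.
  exact: (@leq_bigmax _ (fun i : 'I_N => size (f (xi i))) (Ordinal lt)).
by rewrite -expr_integ_xi -(EndME f) f0 linear0.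
Qed.

(** For operators on polynomials the second equation in the congruence follows from
    the first, because columns are finite. *)
Lemma asymp_onesided c m n N a :
  a * ∫ ^+ (n + N) = c *: ∫ ^+ (m + N) -> asymp c m n a.
Proof.
move=> aS.
have [] := @expr_der_kill (∂ ^+ (m + N) * a - c *: ∂ ^+ (n + N)) (n + N).
  rewrite mulrBl -mulrA aS -scalerAl -scalerAr !exprTS ?subrr//; exact: der_integ.
move=> L /eqP; rewrite mulrBr mulrA -scalerAr -!exprD subr_eq0 => /eqP E.
exists (N + L)%N; split; last by rewrite !addnA ![(_ + L)%N]addnC.
by rewrite !addnA [in LHS]exprD mulrA aS -scalerAl -exprD.
Qed.

Lemma symbol_asymp c N I a : has_symbol N (c%:P *: 'X^I) a -> asymp c I N a.
Proof.
move=> ha; apply: (@asymp_onesided _ _ _ 0); apply: End_ext_xi => n.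
by rewrite !addn0 EndZE EndME !expr_integ_xi addnC ha symbZ symbXn hornerC addnC.
Qed.

Lemma inverse_asymp a b : I1 K a -> I1 K b -> b * a = 1 -> exists c d I J N M,
  [/\ c * d = 1, (I + J = M + N)%N, asymp c I N a & asymp d J M b].
Proof.
move=> /I1_has_symbol[N [s hs]] /I1_has_symbol[M [t ht]] ba.
have [c [d [I [J [cd IJ sE tE]]]]] := symbol_inverse hs ht ba.
exists c, d, I, J, N, M; split=> //; apply: symbol_asymp.
- by rewrite -sE.
- by rewrite -tE.
Qed.

Lemma eIE i j : eI K i j = ∫ ^+ i * (1 - ∫ * ∂) * ∂ ^+ j.
Proof. by rewrite /eI mulrBr mulr1 mulrBl exprSr exprS !mulrA. Qed.

Lemma KFI_asymp w : KFI K w <-> exists2 c, c != 0 & asymp c 0 0 w.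
Proof.
split=> [[c c0 [f [n [C fE]]] <-]|[c c0 hw]].
  exists c => //; suff : asymp (c * 1 + 0) 0 0 (c%:A + f) by rewrite mulr1 addr0.
  apply: asympD.
    apply: asympZ; rewrite -[X in asymp _ _ _ X]mulr1.
    by apply: (asympST _ 0 0); exact: der_integ.
  exists n; have -> : f = mxop ∫ ∂ C.
    by rewrite fE; apply: eq_bigr => i _; apply: eq_bigr => j _; rewrite eIE.
  by rewrite !scale0r mxop_exprS ?exprT_mxop//; exact: der_integ.
exists c => //; exists (w - c%:A); last by rewrite addrC subrK.
have : asymp 0 0 0 (w - c%:A).
  suff: asymp (c + - c * 1) 0 0 (w - c%:A) by rewrite mulr1 subrr.
  apply: asympD => //; rewrite -scaleNr; apply: asympZ.
  rewrite -[X in asymp _ _ _ X]mulr1.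
  by apply: (asympST _ 0 0); exact: der_integ.
case/(asymp_mxop der_integ vacuum_corner) => N [C ->].
exists N, C; rewrite scale0r add0r.
by apply: eq_bigr => i _; apply: eq_bigr => j _; rewrite eIE.
Qed.

Lemma KFI_I1 w : KFI K w -> I1 K w.
Proof.
case=> c _ [f [n [C ->]] <-]; apply: I1_D; first exact: I1_Z I1_1.
apply: I1_sum => i; apply: I1_sum => j; apply: I1_Z.
by apply: I1_B; apply: I1_M; apply: I1_X; first [exact: I1_integ | exact: I1_der].
Qed.

Lemma asymp00_I1 c w : c != 0 -> asymp c 0 0 w -> I1 K w.
Proof. by move=> c0 hw; apply: KFI_I1; apply/KFI_asymp; exists c. Qed.

(** * Factorizations of one-sided invertible operators *)

Lemma left_fraction_asymp n a :
  [set w * ∫ ^+ n | w in KFI K] a <-> exists2 c, c != 0 & asymp c n 0 a.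
Proof.
split=> [[w /KFI_asymp[c c0 hw] <-]|[c c0]]; last first.
  move=> /(asymp_left_shift der_integ)[w hw ->].
  by exists w => //; apply/KFI_asymp; exists c.
exists c => //; rewrite -[c in asymp c]mulr1; apply: asympM (asympS n hw) _.
by rewrite add0n -[_ ^+ n]mulr1; apply: (asympST _ n 0); exact: der_integ.
Qed.

Lemma right_fraction_asymp n b :
  [set ∂ ^+ n * w | w in KFI K] b <-> exists2 c, c != 0 & asymp c 0 n b.
Proof.
split=> [[w /KFI_asymp[c c0 hw] <-]|[c c0]]; last first.
  move=> /(asymp_right_shift der_integ)[w hw ->].
  by exists w => //; apply/KFI_asymp; exists c.
exists c => //; rewrite -[c in asymp c]mul1r; apply: asympM _ (asympS n hw).
by rewrite add0n -[_ ^+ n]mul1r; apply: (asympST _ 0 n); exact: der_integ.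
Qed.

(** A unit u and its inverse are both left cancellable, so in their congruences
    neither power of T exceeds the power of S; as the total degrees cancel, both
    are of degree 0. *)
Lemma units_asymp u : I1_units K u -> exists2 c, c != 0 & asymp c 0 0 u.
Proof.
move=> [Iu [v Iv [uv vu]]].
have [c [d [I [J [N [M [cd IJ hu hv]]]]]]] := inverse_asymp Iu Iv vu.
have leN := asymp_left_regular der_integ vacuum_proj_neq0 vacuum_corner hu
  (left_regular_left_inverse vu).
have leM := asymp_left_regular der_integ vacuum_proj_neq0 vacuum_corner hv
  (left_regular_left_inverse uv).
exists c; first by apply: contra_eq_neq cd => ->; rewrite mul0r eq_sym oner_eq0.
apply: (@asympW _ _ _ _ _ _ _ N); rewrite !add0n.
have IN : I = N by lia.
by rewrite IN in hu.
Qed.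

Lemma asymp_left_factor c n a : c != 0 -> asymp c n 0 a -> left_regular a ->
  [set u * ∫ ^+ n | u in I1_units K] a.
Proof.
move=> c0 ha rega.
have [u [v [hu hv uv vu aE]]] := asymp_unit_completion der_integ
  vacuum_proj_neq0 vacuum_corner c0 ha rega.
exists u => //; split; first exact: asymp00_I1 hu.
by exists v => //; apply: asymp00_I1 hv; rewrite invr_eq0.
Qed.

(** With a = u S^n, the element b u is a left inverse of S^n, hence T^n (1 + g) with
    1 + g a unit of I1. *)
Lemma asymp_right_factor c n a b :
  I1 K b -> c != 0 -> asymp c n 0 a -> b * a = 1 ->
  [set ∂ ^+ n * u | u in I1_units K] b.
Proof.
move=> Ib c0 ha ba.
have [u [Iu [v Iv [uv vu]]] aE] :=
  asymp_left_factor c0 ha (left_regular_left_inverse ba).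
have bu1 : b * u * ∫ ^+ n = 1 by rewrite -mulrA aE.
have /= := left_inverse_exprS der_integ bu1; set g := _ * (1 - _) => -[gg bu].
have Ig : I1 K g.
  by repeat first [apply: I1_M | apply: I1_B | apply: I1_X];
    rewrite //; first [exact: I1_integ | exact: I1_der | exact: I1_1].
exists ((1 + g) * v); last by rewrite mulrA -bu -mulrA uv mulr1.
have Iw : I1 K ((1 + g) * v) by apply: I1_M => //; apply: I1_D => //; exact: I1_1.
split=> //; exists (u * (1 - g)).
  by apply: I1_M => //; apply: I1_B => //; exact: I1_1.
have gK : (1 + g) * (1 - g) = 1.
  by rewrite mulrDl mul1r mulrBr mulr1 gg subr0 subrK.
have Kg : (1 - g) * (1 + g) = 1.
  by rewrite mulrBl mul1r mulrDr mulr1 gg addr0 addrK.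
split; first by rewrite mulrA -(mulrA _ v) vu mulr1.
by rewrite mulrA -(mulrA u) Kg mulr1.
Qed.

(** Left invertibility excludes negative degrees, since it implies left
    cancellability. *)
Lemma LI_asymp a : LI K a -> exists c n, c != 0 /\ asymp c n 0 a.
Proof.
move=> [Ia [b Ib ba]].
have [c [d [I [J [N [M [cd IJ ha hb]]]]]]] := inverse_asymp Ia Ib ba.
have leN := asymp_left_regular der_integ vacuum_proj_neq0 vacuum_corner ha
  (left_regular_left_inverse ba).
exists c, (I - N)%N; split.
  by apply: contra_eq_neq cd => ->; rewrite mul0r eq_sym oner_eq0.
by apply: (@asympW _ _ _ _ _ _ _ N); rewrite subnK.
Qed.

Lemma injective_left_regular (a : End K) : injective a -> left_regular a.
Proof.
move=> inj f af; apply: End_ext => p; apply: inj.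
by rewrite -EndME af End0E linear0.
Qed.

Definition rank1 (p : P) : End K := p \*o (1 - ∫ * ∂ : End K).

Lemma rank1E p q : rank1 p q = q`_0 *: p.
Proof.
by rewrite -[LHS]/(p * (1 - ∫ * ∂ : End K) q) vacuum_projE mulrC mul_polyC.
Qed.

Lemma expr_der_xi k m : (∂ ^+ k) (xi m) = if (k <= m)%N then xi (m - k) else 0.
Proof.
case: leqP => [/subnKC {1}<-|lt].
  by rewrite -expr_integ_xi -EndME exprTS//; exact: der_integ.
rewrite expr_derE derivn_poly0//; apply: leq_trans (size_scale_leq _ _) _.
by rewrite size_polyXn.
Qed.

Lemma sum_EndE n (F : 'I_n -> End K) p : (\sum_i F i) p = \sum_i F i p.
Proof. exact: (big_morph (fun f : End K => f p)). Qed.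

(** On basis vectors of index at least N, a multiple of S^n is already a right
    inverse. The remaining finitely many are sent to chosen preimages under b,
    which changes the operator by an element of F. *)
Lemma surjective_right_inverse c n b : c != 0 -> asymp c 0 n b ->
  (forall q, exists p, b p = q) -> exists2 a, asymp c^-1 n 0 a & b * a = 1.
Proof.
move=> c0 [N [bS _]] /choice[p bp].
pose a : End K := c^-1 *: (∫ ^+ (n + N) * ∂ ^+ N) +
  \sum_(k < N) rank1 (p (xi k)) * ∂ ^+ k.
have a_hi : a * ∫ ^+ N = c^-1 *: ∫ ^+ (n + N).
  rewrite mulrDl -scalerAl -mulrA exprTS ?mulr1; last exact: der_integ.
  rewrite mulr_suml big1 ?addr0// => k _; apply: End_ext => q.
  have -> : ∫ ^+ N = ∫ ^+ (k + (N - k.+1).+1) :> End K.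
    by rewrite -addSnnS subnKC.
  rewrite -mulrA exprTSD; last exact: der_integ.
  by rewrite EndME rank1E exprS EndME coef_integ scale0r.
exists a; first by apply: (@asymp_onesided _ _ _ N).
apply: End_ext_xi => m; rewrite EndME.
have [lt|/subnKC <-] := ltnP m N; last first.
  rewrite -expr_integ_xi -(EndME a) a_hi EndZE linearZ/= -(EndME b) bS EndZE.
  by rewrite scalerA mulVf// scale1r.
rewrite EndDE EndZE EndME expr_der_xi leqNgt lt/= linear0 scaler0 add0r.
rewrite sum_EndE (@big_only1 _ _ _ _ (Ordinal lt))//.
  rewrite EndME rank1E expr_der_xi/= leqnn subnn coef_xi fact0 divr1 scale1r.
  exact: bp.
move=> k km _; rewrite EndME rank1E expr_der_xi; case: leqP => [le|_].
  rewrite coef_xi eq_sym subn_eq0 leqNgt ltn_neqAle le andbT.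
  by rewrite (km : k != m :> nat) mul0r scale0r.
by rewrite coef0 scale0r.
Qed.

(** * The monoids of left and of right invertible elements *)

Lemma genSubmonoid_closed (R : pzRingType) (G : set R) :
  [/\ genSubmonoid G 1, G `<=` genSubmonoid G &
    forall a b, genSubmonoid G a -> genSubmonoid G b -> genSubmonoid G (a * b)].
Proof.
split.
- by move=> M [[+ _] _]; rewrite inE.
- by move=> a Ga M [_]; apply.
- move=> a b Ga Gb M CM; have [[_ +] _] := CM => /(_ a b).
  by rewrite !inE; apply; [exact: Ga CM | exact: Gb CM].
Qed.

Lemma genSubmonoid_X (R : pzRingType) (G : set R) a n :
  G a -> genSubmonoid G (a ^+ n).
Proof.
have [G1 GG GM] := genSubmonoid_closed G.
by move=> /GG Ga; elim: n => // n IHn; rewrite exprS; apply: GM.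
Qed.

Lemma I1_units1 : I1_units K 1.
Proof. by split; [exact: I1_1|exists 1; rewrite ?mulr1//; exact: I1_1]. Qed.

Lemma LInE n : LIn K n = [set u * ∫ ^+ n | u in I1_units K].
Proof.
apply/seteqP; split=> a /=.
  move=> [/left_fraction_asymp[c c0 ha] /injective_left_regular rega].
  exact: asymp_left_factor ha rega.
move=> [u uU <-]; split; first by exists u => //; exact/KFI_asymp/units_asymp.
have [_ [v _ [_ vu]]] := uU.
apply: (can_inj (g := ∂ ^+ n * v)) => p.
rewrite -EndME -mulrA (mulrA v) vu mul1r.
by rewrite exprTS//; exact: der_integ.
Qed.

Lemma RInE n : RIn K n = [set ∂ ^+ n * u | u in I1_units K].
Proof.
apply/seteqP; split=> b /=.
  move=> [hb surj]; have /right_fraction_asymp[c c0 bc] := hb.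
  have [a ha ba] := surjective_right_inverse c0 bc surj.
  apply: asymp_right_factor ha ba; last by rewrite invr_eq0.
  have [w /KFI_I1 Iw <-] := hb.
  by apply: I1_M => //; apply: I1_X; exact: I1_der.
move=> [u uU <-]; split; first by exists u => //; exact/KFI_asymp/units_asymp.
have [_ [v _ [uv _]]] := uU => q; exists ((v * ∫ ^+ n) q).
rewrite -EndME -mulrA (mulrA u) uv mul1r.
by rewrite exprTS//; exact: der_integ.
Qed.

Lemma LIE : LI K = genSubmonoid (I1_units K `|` [set ∫]).
Proof.
have [G1 GG GM] := genSubmonoid_closed (I1_units K `|` [set ∫]).
apply/seteqP; split=> [a La|].
  have [c [n [c0 ha]]] := LI_asymp La; have [_ [b _ ba]] := La.
  have [u uU <-] := asymp_left_factor c0 ha (left_regular_left_inverse ba).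
  by apply: GM; [apply: GG; left | apply: genSubmonoid_X; right].
apply: smallest_sub => [|a [[Ia [v Iv [_ vu]]]|->]].
- split.
    by rewrite inE; split; [exact: I1_1|exists 1; rewrite ?mulr1//; exact: I1_1].
  move=> a b; rewrite !inE => -[Ia [a' Ia' aa]] [Ib [b' Ib' bb]].
  split; first exact: I1_M.
  exists (b' * a'); first exact: I1_M.
  by rewrite mulrA -(mulrA b') aa mulr1.
- by split=> //; exists v.
- by split; [exact: I1_integ|exists ∂; [exact: I1_der|exact: der_integ]].
Qed.

Lemma RIE : RI K = genSubmonoid (I1_units K `|` [set ∂]).
Proof.
have [G1 GG GM] := genSubmonoid_closed (I1_units K `|` [set ∂]).
apply/seteqP; split=> [b [Ib [a Ia ba]]|].
  have [c [n [c0 ha]]] : exists c n, c != 0 /\ asymp c n 0 a.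
    by apply: LI_asymp; split=> //; exists b.
  have [u uU <-] := asymp_right_factor Ib c0 ha ba.
  by apply: GM; [apply: genSubmonoid_X; right | apply: GG; left].
apply: smallest_sub => [|a [[Ia [v Iv [uv _]]]|->]].
- split.
    by rewrite inE; split; [exact: I1_1|exists 1; rewrite ?mulr1//; exact: I1_1].
  move=> a b; rewrite !inE => -[Ia [a' Ia' aa]] [Ib [b' Ib' bb]].
  split; first exact: I1_M.
  exists (b' * a'); first exact: I1_M.
  by rewrite mulrA -(mulrA a) bb mulr1.
- by split=> //; exists v.
- by split; [exact: I1_der|exists ∫; [exact: I1_integ|exact: der_integ]].
Qed.

(** Shifting a congruence to c S^n into one to c S^(n + m) T^m makes it composable
    with a congruence to d S^m. *)
Lemma LInM n m : [set a * b | a in LIn K n & b in LIn K m] = LIn K (n + m).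
Proof.
apply/seteqP; split=> x /=; last first.
  rewrite LInE => -[u uU <-]; rewrite exprD mulrA.
  exists (u * ∫ ^+ n); first by rewrite LInE; exists u.
  exists (∫ ^+ m) => //; rewrite LInE; exists 1; last by rewrite mul1r.
  exact: I1_units1.
move=> [a [/left_fraction_asymp[c c0 ha] ainj]].
move=> [b [/left_fraction_asymp[d d0 hb] binj]] <-.
split; last exact: inj_comp ainj binj.
apply/left_fraction_asymp; exists (c * d); first by rewrite mulf_neq0.
by apply: asympM hb; have := asympS m ha; rewrite add0n.
Qed.

Lemma RInM n m : [set a * b | a in RIn K n & b in RIn K m] = RIn K (n + m).
Proof.
apply/seteqP; split=> x /=; last first.
  rewrite RInE => -[u uU <-]; rewrite exprD -mulrA.
  exists (∂ ^+ n).
    by rewrite RInE; exists 1; [exact: I1_units1|rewrite mulr1].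
  by exists (∂ ^+ m * u) => //; rewrite RInE; exists u.
move=> [a [/right_fraction_asymp[c c0 ha] asurj]].
move=> [b [/right_fraction_asymp[d d0 hb] bsurj]] <-.
split; last by move=> q; have [p <-] := asurj q; have [r <-] := bsurj p; exists r.
apply/right_fraction_asymp; exists (c * d); first by rewrite mulf_neq0.
by apply: asympM ha _; have := asympS n hb; rewrite add0n addnC.
Qed.

End Operators.

Unset Implicit Arguments.

Theorem theorem7p3 (K : fieldType) (charK0 : [pchar K] =i pred0) :
  [/\ LI K = genSubmonoid (I1_units K `|` [set integ]),
      (forall n, LIn K n = [set u * integ ^+ n | u in I1_units K]) /\
      (forall n m, [set a * b | a in LIn K n & b in LIn K m] = LIn K (n + m)),
      RI K = genSubmonoid (I1_units K `|` [set der]) &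
      (forall n, RIn K n = [set der ^+ n * u | u in I1_units K]) /\
      (forall n m, [set a * b | a in RIn K n & b in RIn K m] = RIn K (n + m))].
Proof.
split; [exact: LIE| |exact: RIE|]; split=> *;
  [exact: LInE|exact: LInM|exact: RInE|exact: RInM].
Qed.
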